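(* Let $\mathbf{K}$ be a field of characteristic different from $2$ and let $A$ be a (not necessarily associative) algebra over $\mathbf{K}$. For $a,b,c\in A$ put $\langle a,b,c\rangle=(ab)c-a(bc)+b(ac)$. Then $A$ is a binary Leibniz algebra if and only if $A$ satisfies the identities $$\langle a,a,b\rangle=0,\qquad \langle a,b,a\rangle=0,\qquad \langle a,b,ab\rangle=0\qquad\text{for all } a,b\in A.$$
   Context: A (left) Leibniz algebra is an algebra satisfying $(ab)c=a(bc)-b(ac)$ for all $a,b,c$, i.e. $\langle a,b,c\rangle=0$. An algebra $A$ is called a binary Leibniz algebra if every subalgebra of $A$ generated by two elements is a Leibniz algebra. *)

(* Defs.v *)
From HB Require Import structures.
From mathcomp Require Import all_boot all_algebra.
Set Implicit Arguments. Unset Strict Implicit. Unset Printing Implicit Defensive.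
Import GRing.Theory.
Local Open Scope ring_scope.

Definition bilinear_mul (K : fieldType) (V : lmodType K) (m : V -> V -> V) :=
  (forall (k : K) (x y z : V), m (k *: x + y) z = k *: m x z + m y z) /\
  (forall (k : K) (x y z : V), m x (k *: y + z) = k *: m x y + m x z).

Definition leib (K : fieldType) (V : lmodType K) (m : V -> V -> V) (a b c : V) : V :=
  m (m a b) c - m a (m b c) + m b (m a c).

Definition subalgebra (K : fieldType) (V : lmodType K) (m : V -> V -> V) (S : V -> Prop) :=
  [/\ S 0, (forall (k : K) x y, S x -> S y -> S (k *: x + y))
     & (forall x y, S x -> S y -> S (m x y))].

Definition gen2 (K : fieldType) (V : lmodType K) (m : V -> V -> V) (a b x : V) :=
  forall S : V -> Prop, subalgebra m S -> S a -> S b -> S x.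

Definition binary_leibniz (K : fieldType) (V : lmodType K) (m : V -> V -> V) :=
  forall a b x y z : V, gen2 m a b x -> gen2 m a b y -> gen2 m a b z ->
    leib m x y z = 0.

(* Main.v *)
Require Import Defs.
From HB Require Import structures.
From mathcomp Require Import all_boot all_algebra ring.
Set Implicit Arguments. Unset Strict Implicit. Unset Printing Implicit Defensive.
Import GRing.Theory.
Local Open Scope ring_scope.

(** Under the three identities [leib] is alternating, and [(ab + ba)c = 0].
    By induction on the total degree [n], [leib u v w = 0] for all monomials
    [u, v, w] in two fixed elements [x, y].  Once this holds below degree [n],
    the degree-[n] part [F] of [leib] is an alternating trilinear form on an
    algebra whose product may be treated as a Lie bracket under [F], and the
    linearization of [leib (ab) a b = 0] says that
    [H a b c d = F (ab) c d + F (cd) a b] is alternating.  In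
    [F a v (bw) = F b (av) w + H a v b w], the term [H] is the obstruction to
    moving letters from one argument to another.

    The Jacobi identity for left multiplications gives [3 H = 0].  If 3 is
    invertible, then [H = 0], letters move freely, and reversing words shows
    that [F x y (D z E z) = 0] for [z = xy] and all words [D, E] in [x, y].

    In characteristic 3, [H] need not vanish on three generators.  There the
    functionals [w |-> F x y (D w)] form a right module over the free
    associative algebra on [x, y], and by induction on the length of [D] the
    elements [xx], [yy] and [xy + yx] act centrally on it, as in a Clifford
    algebra; so [z = xy - yx] anticommutes with [x] and [y].  Moving [z] to the
    right until it meets the last [z] again gives [F x y (D z E z) = 0].

    In both cases the order of the letters in [F x y (D z)] is irrelevant, while
    reversing it changes the sign; so this vanishes, and then so does [F]. *)

(* The square-zero extension of K by V: [ring] has no support for modules, so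
   identities in V are proved for the elements (0, v) of this commutative ring. *)
Section TrivialExtension.
Context (K : fieldType) (V : lmodType K).
Definition trivext : Type := (K * V)%type.

HB.instance Definition _ := GRing.Zmodule.copy trivext (K * V)%type.

Definition te_one : trivext := (1, 0).
Definition te_mul (a b : trivext) : trivext := (a.1 * b.1, a.1 *: b.2 + b.1 *: a.2).

Lemma te_mulA : associative te_mul.
Proof.
move=> [a u] [b v] [c w]; rewrite /te_mul /=.
rewrite mulrA !scalerDr !scalerA addrA.
by rewrite (mulrC c a) (mulrC c b).
Qed.

Lemma te_mulC : commutative te_mul.
Proof. by move=> [a u] [b v]; rewrite /te_mul /= mulrC addrC. Qed.

Lemma te_mul1 : left_id te_one te_mul.
Proof. by case=> a b; rewrite /te_mul /= mul1r scale1r scaler0 addr0. Qed.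

Lemma te_mulDl : left_distributive te_mul +%R.
Proof. by move=> [a u] [b v] [c w]; rewrite /te_mul /= ?mulrDl // scalerDl scalerDr addrACA. Qed.

Lemma te_oner_neq0 : te_one != 0.
Proof. by apply/eqP => -[/eqP]; rewrite oner_eq0. Qed.

HB.instance Definition _ := GRing.Zmodule_isComNzRing.Build trivext
  te_mulA te_mulC te_mul1 te_mulDl te_oner_neq0.

Lemma trivext_mulrn (r : trivext) k : r *+ k = (r.1 *+ k, r.2 *+ k) :> trivext.
Proof. by elim: k => [//|k IH]; rewrite mulrS IH !mulrS. Qed.

End TrivialExtension.

(** Backs the tactic [linear]: a goal follows from a linear combination of known equations once
    [ring] finds the two differences of sides equal. *)
Lemma lincomb (R : comNzRingType) (a b c d : R) : c = d -> a - b = c - d -> a = b.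
Proof. by move=> -> /eqP; rewrite subrr subr_eq0 => /eqP. Qed.

Lemma eqD (R : comNzRingType) (a b c d : R) : a = b -> c = d -> a + c = b + d.
Proof. by move=> -> ->. Qed.

Lemma eqB (R : comNzRingType) (a b c d : R) : a = b -> c = d -> a - c = b - d.
Proof. by move=> -> ->. Qed.

Lemma eqM (R : comNzRingType) (k a b : R) : a = b -> k * a = k * b.
Proof. by move=> ->. Qed.

Local Notation "e1 :+ e2" := (eqD e1 e2) (at level 50, left associativity).
Local Notation "e1 :- e2" := (eqB e1 e2) (at level 50, left associativity).
Local Notation "k :* e" := (eqM k e) (at level 40).

Ltac linear e := apply: (lincomb e); ring.

(* [T] stands for monomials and [F] for the degree-n part of [leib], so [T]
   carries no addition, and [F_anti] and [F_jac] hold in the last argument of [F]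
   under any left multiplications [D].  [F_dbl]: 2 is not a zero divisor. *)
Record cocycle (T : Type) (br : T -> T -> T) (R : comNzRingType) (F : T -> T -> T -> R) : Prop :=
  Cocycle {
    F_dbl : forall r : R, r + r = 0 -> r = 0;
    F_swap12 : forall u v w, F v u w = - F u v w;
    F_swap23 : forall u v w, F u w v = - F u v w;
    F_bin : forall a b c d,
      F (br a b) c d + F (br c b) a d + F (br a d) c b + F (br c d) a b = 0;
    F_cocyc : forall a b c d,
      F (br a b) c d + F (br c d) a b + F (br b c) a d + F (br a d) b c
      + F (br c a) b d + F (br b d) c a = 0;
    F_jac : forall D u v a b c, F u v (foldr br (br (br a b) c) D) =
      F u v (foldr br (br a (br b c)) D) - F u v (foldr br (br b (br a c)) D);
    F_anti : forall D u v a b,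
      F u v (foldr br (br a b) D) = - F u v (foldr br (br b a) D)
  }.

(** * The obstruction [H] and its relations *)

Section Form.
Context (T : Type) (br : T -> T -> T) (R : comNzRingType) (F : T -> T -> T -> R).
Hypothesis cF : cocycle br F.
Local Notation "a ** b" := (br a b) (at level 38, right associativity).

Let dbl := F_dbl cF.
Let sw12 := F_swap12 cF.
Let sw23 := F_swap23 cF.

Lemma Fcyc u v w : F u v w = F v w u.
Proof. by rewrite sw12 sw23 opprK. Qed.

Lemma Fjac u v a b c : F u v ((a ** b) ** c) = F u v (a ** b ** c) - F u v (b ** a ** c).
Proof. exact: (F_jac cF [::]). Qed.

Lemma Fanti u v a b : F u v (a ** b) = - F u v (b ** a).
Proof. exact: (F_anti cF [::]). Qed.

Definition H a b c d := F (a ** b) c d + F (c ** d) a b.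

Lemma H_swap12 a b c d : H b a c d = - H a b c d.
Proof.
rewrite /H (sw23 (c ** d)) !(Fcyc (_ ** _)) (Fanti _ _ b a).
by rewrite opprD.
Qed.

Lemma H_swap34 a b c d : H a b d c = - H a b c d.
Proof. by rewrite /H addrC -/(H d c a b) H_swap12 /H addrC. Qed.

(** Regrouped, [F_bin] reads H a b c d + H c b a d = 0; with skewness inside each pair this makes
    [H] alternating. *)
Lemma H_swap13 a b c d : H c b a d = - H a b c d.
Proof. rewrite /H; linear (F_bin cF a b c d). Qed.

Lemma H_swap23 a b c d : H a c b d = - H a b c d.
Proof. by rewrite H_swap12 H_swap13 H_swap12 opprK. Qed.

Lemma H_swap24 a b c d : H a d c b = - H a b c d.
Proof. by rewrite H_swap34 H_swap23 H_swap34 opprK. Qed.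

Lemma H_eq13 a b d : H a b a d = 0.
Proof. by apply: dbl; rewrite {1}(H_swap13 a b a d) addNr. Qed.

Lemma F_move a v b w : F a v (b ** w) = F b (a ** v) w + H a v b w.
Proof. by rewrite /H (sw23 b w) (Fcyc (a ** v)) (Fcyc (b ** w)) addrA addNr add0r. Qed.

Lemma F_move_eq a v w : F a v (a ** w) = F a (a ** v) w.
Proof. by rewrite F_move H_eq13 addr0. Qed.

Lemma H_split x y v w : H x v y w = - F x y (v ** w) - F (x ** y) v w.
Proof. by rewrite H_swap23 /H (Fcyc (v ** w)) opprD addrC. Qed.

(* [z = xy] is expanded in the two forms of [H x v z w = - H x w z v]. *)
Lemma H_cons x y v w :
  2 * H x (x ** v) y w - 3 * H x v y (x ** w) =
  F y v (x ** x ** w) - F x v (y ** x ** w) - F x v ((x ** y) ** w)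
  - F x y (x ** v ** w) + 2 * F x y (v ** x ** w).
Proof.
have e1 := F_move x v (x ** y) w.
have e2 : F x w ((x ** y) ** v) = F (x ** y) (x ** w) v - H x v (x ** y) w.
  by rewrite F_move (H_swap24 x v).
have h1 : F (x ** y) (x ** v) w =
    - H x (x ** v) y w - F x y (x ** v ** w) + F x y (v ** x ** w).
  by rewrite H_split Fjac; ring.
have h2 : F (x ** y) (x ** w) v = H x v y (x ** w) + F x y (v ** x ** w).
  by rewrite H_swap24 H_split Fanti; ring.
have h3 : F x w ((x ** y) ** v) = - F y v (x ** x ** w) + F x v (y ** x ** w)
    + H x (x ** v) y w - 2 * H x v y (x ** w).
  rewrite Fjac F_move_eq [F x _ (y ** v)]F_move [F x w (y ** _)]F_move.
  rewrite [F y _ (x ** v)]F_move (H_swap13 x _ y) (H_swap24 x v y (x ** w)).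
  by rewrite (H_swap24 x (x ** v)) (sw23 y v) (sw23 x v); ring.
linear (h1 :+ h2 :+ e1 :+ e2 :- h3).
Qed.

(** In the sum of the two instances of [H_split], F (xy) (xc) w cancels by skewness, and so does H x
    y c (xw) once the other terms are expanded by [half]. *)
Lemma H_adx_sym x y c w :
  3 * (H x (x ** c) y w + H x (x ** y) c w) =
  F x (c ** x ** y) w + F x (y ** x ** c) w
  - F c (x ** x ** y) w - F y (x ** x ** c) w.
Proof.
have half a b : F x a ((x ** b) ** w) = F b (x ** x ** a) w
    + 2 * H x (x ** a) b w - F x (b ** x ** a) w - H x a b (x ** w).
  rewrite Fjac F_move_eq ![F x _ (b ** _)]F_move [F b (x ** a) (x ** w)]F_move.
  by rewrite (H_swap13 x _ b); ring.
have h1 := H_split x y (x ** c) w.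
have h2 := H_split x c (x ** y) w.
have h3 := sw12 (x ** y) (x ** c) w.
have h4 := H_swap23 x y c (x ** w).
linear (h1 :+ h2 :- half y c :- half c y :- h3 :+ h4).
Qed.

(** * Words in two letters: vanishing of [F] reduced to two conditions on words *)

Section Letters.
Variables x y : T.

Definition lt b := if b then x else y.

Definition lword (D : seq bool) (w : T) := foldr br w (map lt D).

Lemma lword_rcons D b w : lword (rcons D b) w = lword D (lt b ** w).
Proof. by rewrite /lword map_rcons foldr_rcons. Qed.

Lemma lword_cat D E w : lword (D ++ E) w = lword D (lword E w).
Proof. by rewrite /lword map_cat foldr_cat. Qed.

End Letters.

(* [xy] plays the role of x + y. *)
Section Vanishing.
Variables x y xy : T.
Local Notation lt := (lt x y).
Local Notation word := (lword x y).
Hypothesis xy_act : forall D u v w, F u v (foldr br (xy ** w) D) =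
  F u v (foldr br (x ** w) D) + F u v (foldr br (y ** w) D).
Hypothesis xy_leaf : forall D u v, F u v (foldr br xy D) =
  F u v (foldr br x D) + F u v (foldr br y D).
Hypothesis H_words : forall D E, H x (word D (x ** y)) y (word E (x ** y)) = 0.
Hypothesis F_comm : forall D E, F x y (word D ((x ** y) ** word E (x ** y))) = 0.

Inductive generated : T -> Prop :=
| gen_lt b : generated (lt b)
| gen_sum : generated xy
| gen_br u v : generated u -> generated v -> generated (u ** v).

(** The letters of D pass one by one into the third argument by [F_move], hence arrive reversed;
    each obstruction is zero by [H_words] or by alternation of [H]. *)
Lemma F_letter_words b D E :
  F (lt b) (word D (x ** y)) (word E (x ** y)) =
  F x y (word (catrev D (b :: E)) (x ** y)).
Proof.
elim: D b E => [|a D IH] b E /=.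
  case: b => /=; first by rewrite F_move_eq.
  by rewrite -Fcyc Fanti Fcyc -F_move_eq sw12 opprK.
rewrite -IH /= F_move.
by case: a b => [] [] /=; rewrite ?H_eq13 ?(H_swap13 x) ?H_words ?oppr0 addr0.
Qed.

Let lam D := F x y (word D (x ** y)).

Lemma lam_swap D a b E : lam (D ++ [:: a, b & E]) = lam (D ++ [:: b, a & E]).
Proof.
have e : lam (D ++ [:: true, false & E]) = lam (D ++ [:: false, true & E]).
  apply: subr0_eq; rewrite -(F_comm D E) /lam !lword_cat.
  by rewrite [in RHS]/lword (F_jac cF).
by case: a b => [] [].
Qed.

Lemma lam_rev D E : lam (D ++ rev E) = lam (D ++ E).
Proof.
have shift a C D' : lam (D' ++ rcons C a) = lam (D' ++ a :: C).
  elim: C D' => //= c C IH D'.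
  by rewrite lam_swap -cat_rcons IH cat_rcons.
elim: E D => // a E IH D.
by rewrite rev_cons shift -!cat_rcons IH.
Qed.

(** The words bD and (rev D)b come from the two sides of F b z (D z) = - F b (D z) z. Reversal does
    not change [lam], so its value equals its negative. *)
Lemma lam0 D : lam D = 0.
Proof.
apply: dbl; case: D => [|b D].
  rewrite {1}/lam /lword /= F_move_eq sw23.
  by rewrite addNr.
rewrite -{1}[lam _](F_letter_words b [::] D) -(lam_rev [::]) rev_cons -cats1 -catrevE.
by rewrite -[lam _](F_letter_words b D [::]) sw23 addNr.
Qed.

(** By [F_jac], left multiplication by a product acts under F u v as a commutator of left
    multiplications, so every generated element acts through words in the letters. *)
Lemma generated_vanish u v : (forall D b, F u v (word D (lt b)) = 0) ->
  forall t, generated t -> F u v t = 0.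
Proof.
move=> w0.
have act s : generated s -> forall w, (forall D, F u v (word D w) = 0) ->
    forall D, F u v (word D (s ** w)) = 0.
  elim=> {s} [b|| s t _ IHs _ IHt] w Vw D.
  - by rewrite -lword_rcons.
  - by rewrite /lword xy_act -/(word D (lt true ** w)) -/(word D (lt false ** w))
      -!lword_rcons !Vw addr0.
  - rewrite /lword (F_jac cF).
    have := IHs _ (IHt _ Vw) D; have := IHt _ (IHs _ Vw) D.
    by rewrite /lword => -> ->; rewrite subr0.
suff V t : generated t -> forall D, F u v (word D t) = 0 by move=> t /V/(_ [::]).
elim=> {t} [b|| s t gs _ _ Vt] D; [exact: w0| |exact: act].
by rewrite /lword xy_leaf -/(word D (lt true)) -/(word D (lt false)) !w0 addr0.
Qed.

Lemma F_diag u w : (F u u w = 0) * (F u w u = 0) * (F w u u = 0).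
Proof.
have e a b : F a a b = 0 by apply: dbl; rewrite {1}sw12 addNr.
by do !split; [exact: e|rewrite sw23 e oppr0|rewrite Fcyc e].
Qed.

(** Words ending in xx or yy vanish by anticommutativity and yx becomes -xy, which leaves the words
    D (xy) and the bare letters. *)
Lemma words_vanish u v : (forall D, F u v (word D (x ** y)) = 0) ->
  (forall b, F u v (lt b) = 0) -> forall t, generated t -> F u v t = 0.
Proof.
move=> w0 l0; apply: generated_vanish => D b; case/lastP: D => [|D d]; first exact: l0.
rewrite lword_rcons; case: d b => [] []; rewrite ?w0 //.
- by apply: dbl; rewrite /lword {1}(F_anti cF) addNr.
- by rewrite /lword (F_anti cF) -/(word D (x ** y)) w0 oppr0.
- by apply: dbl; rewrite /lword {1}(F_anti cF) addNr.
Qed.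

Lemma generated_word D : generated (word D (x ** y)).
Proof.
elim: D => [|d D IH]; last exact: gen_br (gen_lt d) IH.
exact: gen_br (gen_lt true) (gen_lt false).
Qed.

Lemma F_two_letters b c t : generated t -> F (lt b) (lt c) t = 0.
Proof.
apply: words_vanish => [D|d]; case: b c => [] []; rewrite ?F_diag //.
- exact: lam0.
- by rewrite sw12 [F _ _ _]lam0 oppr0.
- by case: d; rewrite F_diag.
- by case: d; rewrite F_diag.
Qed.

Lemma F_letter b s t : generated s -> generated t -> F (lt b) s t = 0.
Proof.
move=> gs; apply: words_vanish => [D|d]; last by rewrite sw23 F_two_letters ?oppr0.
rewrite sw23 (words_vanish _ _ gs) ?oppr0 // => [E|d].
  by rewrite F_letter_words [LHS]lam0.
by rewrite sw23 F_two_letters ?oppr0 //; exact: generated_word.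
Qed.

Theorem generated_zero s t r : generated s -> generated t -> generated r -> F s t r = 0.
Proof.
move=> gs gt.
(* When [F] vanishes on triples containing a letter, skewness of [H] loses one term on each side and
   lets a letter pass from the first argument to the second. *)
have act b u v w : generated u -> generated v -> generated w ->
    F (lt b ** u) v w = F u (lt b ** v) w.
  move=> gu gv gw; have := H_swap23 (lt b) u v w; rewrite /H.
  rewrite !(Fcyc (_ ** _) (lt b)) !F_letter ?addr0 //; try exact: gen_br.
  by rewrite (sw12 _ u) => ->; rewrite opprK.
have word0 D u v : generated u -> generated v -> F (word D (x ** y)) u v = 0.
  elim: D u => [|d D IH] u gu gv /=.
    rewrite (act true) ?(F_letter false) //; try exact: (gen_lt false).
    exact: gen_br (gen_lt true) gu.
  by rewrite act ?IH //; [exact: gen_br (gen_lt d) gu|exact: generated_word].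
apply: words_vanish => [D|b]; first by rewrite -Fcyc word0.
by rewrite -Fcyc F_letter.
Qed.

End Vanishing.

(** * The case where 3 is not a zero divisor *)

Section CharNot3.
Hypothesis three_free : forall r : R, 3 * r = 0 -> r = 0.

(** [F_cocyc] is the cyclic sum H a b c d + H b c a d + H c a b d, and alternation makes its three
    terms equal. *)
Lemma H_eq0 a b c d : H a b c d = 0.
Proof.
apply: three_free; have := F_cocyc cF a b c d.
have e1 : H b c a d = H a b c d by rewrite H_swap23 H_swap12 opprK.
have e2 : H c a b d = H a b c d by rewrite H_swap12 H_swap23 opprK.
by move: e1 e2; rewrite /H => e1 e2 e3; linear (e3 :- e1 :- e2).
Qed.

Lemma F_chain D a v b w :
  F a v (foldr br (b ** w) D) = F b (foldl (fun u d => d ** u) (a ** v) D) w.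
Proof. by elim: D a v => [|d D IH] a v /=; rewrite F_move H_eq0 addr0 ?IH. Qed.

Lemma F_chain_rev x y D b w :
  F x y (foldr br (b ** w) D) = F b (foldr br (x ** y) (rev D)) w.
Proof. by rewrite F_chain -foldl_rev revK. Qed.

(* Reversing a word gives a sign; reversing z = xy - yx as a pair of letters gives
   one more sign than reversing it as a single letter. *)
Lemma F_comm_not3 x y D E : F x y (foldr br ((x ** y) ** foldr br (x ** y) E) D) = 0.
Proof.
set z := x ** y.
have rev_eq L : F x y (foldr br z L) = - F x y (foldr br z (rev L)).
  by rewrite {1}/z F_chain_rev sw23.
have e1 : F x y (foldr br (z ** foldr br z E) D) =
    - F x y (foldr br (z ** foldr br z (rev D)) (rev E)).
  by rewrite (F_chain_rev x y D) (F_chain_rev x y (rev E)) revK sw23.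
have e2 : F x y (foldr br (z ** foldr br z E) D) =
    F x y (foldr br (z ** foldr br z (rev D)) (rev E)).
  have := rev_eq (D ++ [:: x, y & E]); have := rev_eq (D ++ [:: y, x & E]).
  rewrite !rev_cat !rev_cons !foldr_cat /= !foldr_rcons !(F_jac cF) /= => -> ->.
  by rewrite opprK addrC.
by apply: dbl; rewrite {1}e1 e2 addNr.
Qed.

End CharNot3.

(** * Characteristic 3 *)

Section Char3.
Hypothesis three0 : 3 = 0 :> R.

(* [ring: e] rewrites a coefficient only when it is literally the left-hand side
   of [e], hence the list of multiples of 3. *)
Let six0 : 6 = 0 :> R. Proof. by linear (2 :* three0). Qed.
Let nine0 : 9 = 0 :> R. Proof. by linear (3 :* three0). Qed.
Let twelve0 : 12 = 0 :> R. Proof. by linear (4 :* three0). Qed.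
Let N3 : - 3 = 0 :> R. Proof. by rewrite three0 oppr0. Qed.
Let N6 : - 6 = 0 :> R. Proof. by rewrite six0 oppr0. Qed.
Let N9 : - 9 = 0 :> R. Proof. by rewrite nine0 oppr0. Qed.
Let N12 : - 12 = 0 :> R. Proof. by rewrite twelve0 oppr0. Qed.

Ltac ring3 := apply: subr0_eq; ring: three0 N3 six0 N6 nine0 N9 twelve0 N12.
Ltac linear3 e := apply: (lincomb e); ring3.

(** Modulo 3 the right side of [H_adx_sym] vanishes. Taken at xw, this turns the sum into - F x
    ((xc)(xy) + (xy)(xc)) w, which is 0 by anticommutativity. *)
Lemma H_adx2_sym x y c w : H x (x ** x ** y) c w + H x (x ** x ** c) y w = 0.
Proof.
have cyc u : F x (c ** x ** y) u + F x (y ** x ** c) u =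
    F c (x ** x ** y) u + F y (x ** x ** c) u.
  by have := H_adx_sym x y c u; rewrite three0 mul0r => /esym e; linear e.
have := cyc (x ** w).
rewrite !F_move_eq [F c _ _]F_move [F y _ _]F_move (H_swap13 x _ c) (H_swap13 x _ y) => e.
have : F w x ((x ** c) ** (x ** y)) + F w x ((x ** y) ** (x ** c)) = 0.
  by rewrite Fanti addNr.
rewrite !Fjac !(Fcyc w x) => e'.
linear (e :- e').
Qed.

Lemma H_adx2 x y w : H x (x ** x ** y) y w = 0.
Proof. by apply: dbl; rewrite H_adx2_sym. Qed.

(** Three exchanges of v, y, w: [H_adx2_sym] gives the skewness that involves the argument under xx,
    alternation of [H] the rest. *)
Lemma H_sq_selfadjoint x y v w :
  H x (x ** x ** v) y w = H x v y (x ** x ** w).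
Proof.
rewrite [RHS]H_swap24.
have e1 := H_adx2_sym x v y w.
have e2 := H_adx2_sym x w y v.
have e3 := H_swap34 x (x ** x ** y) v w.
linear (e1 :+ e2 :- e3).
Qed.

(** [H] is eliminated between [H_cons] at xv, whose multiple of 3 drops out, and [H_sq_selfadjoint].
    What remains are commutators with xx. *)
Lemma sq_relation x y v w :
  F x v (x ** x ** y ** w) - F x v (y ** x ** x ** w)
  + F x y (x ** x ** v ** w) - F x y (v ** x ** x ** w) = 0.
Proof.
have e1 := H_cons x y (x ** v) w.
have e2 := H_sq_selfadjoint x y v w.
have m1 := F_move x v y (x ** x ** w).
have m2 := F_move_eq x v (y ** x ** w).
have m3 := F_move_eq x v ((x ** y) ** w).
have j1 : F x y (x ** (x ** v) ** w) = _ := F_jac cF [:: x] x y x v w.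
have j2 := Fjac x y x v (x ** w).
have j3 : F x v (x ** (x ** y) ** w) = _ := F_jac cF [:: x] x v x y w.
rewrite /= in j1 j3.
linear3 (e1 :- 2 :* e2 :- m1 :+ m2 :+ m3 :- j3 :- j1 :+ 2 :* j2).
Qed.

(** * Relations for a fixed pair of letters *)

Section Pair.
Variables x y xy : T.
Local Notation lt := (lt x y).
Local Notation word := (lword x y).
Hypothesis xy_act : forall D u v w, F u v (foldr br (xy ** w) D) =
  F u v (foldr br (x ** w) D) + F u v (foldr br (y ** w) D).
Hypothesis xy_leaf : forall u v, F u v xy = F u v x + F u v y.

Let H_xy u w : H xy u y w = H x u y w.
Proof.
have := H_eq13 y u w; rewrite /H !(Fcyc (_ ** _) y) (xy_act [::]) /=.
rewrite -(Fcyc u (y ** w)) xy_leaf !(Fcyc u (y ** w)) => e.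
by rewrite (Fcyc _ y u); linear e.
Qed.

Let H_xy_act D v w : H x (foldr br (xy ** v) D) y w =
  H x (foldr br (x ** v) D) y w + H x (foldr br (y ** v) D) y w.
Proof.
rewrite /H !(Fcyc (_ ** _) y) (xy_act (x :: D)) /=.
by rewrite (xy_act D) /=; ring.
Qed.

(** Polarization: [H_sq_selfadjoint] at x + y, less its cases x and y. *)
Lemma H_cross_selfadjoint v w :
  H x (x ** y ** v) y w + H x (y ** x ** v) y w =
  H x v y (x ** y ** w) + H x v y (y ** x ** w).
Proof.
have e := H_sq_selfadjoint xy y v w.
move: e; rewrite !H_xy [RHS](H_swap24 x _ y v) !(H_xy_act [::]) !(H_xy_act [:: _]) /=.
rewrite !(H_swap24 x v y).
have e1 := H_sq_selfadjoint x y v w.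
have e2 := H_sq_selfadjoint y x v w.
rewrite !(H_swap13 x _ y) in e2.
move=> e.
linear (e :- e1 :+ e2).
Qed.

Lemma H_act b v w :
  H x (lt b ** v) y w = F x v (lt b ** y ** w) - F y v (lt b ** x ** w)
    + F x y (lt b ** v ** w) + F x y (v ** lt b ** w).
Proof.
case: b => /=.
  by have e := H_cons x y v w; rewrite Fjac in e; linear3 (2 :* e).
have e := H_cons y x v w; rewrite Fjac !(H_swap13 x _ y) !(sw12 x y) in e.
by linear3 e.
Qed.

(** Companion of [sq_relation] for xy + yx instead of a square: [H_act] and [F_move] eliminate [H]
    from [H_cross_selfadjoint]. *)
Lemma cross_relation v w :
  F y v (x ** x ** y ** w) - F y v (y ** x ** x ** w)
  + F x v (x ** y ** y ** w) - F x v (y ** y ** x ** w)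
  + F x y (x ** y ** v ** w) + F x y (y ** x ** v ** w)
  - F x y (v ** x ** y ** w) - F x y (v ** y ** x ** w) = 0.
Proof.
have e := H_cross_selfadjoint v w.
have mx u : F x (y ** v) u = F y v (x ** u) + H x v y u.
  by rewrite F_move (H_swap13 x v y); ring.
have my u : F y (x ** v) u = F x v (y ** u) - H x v y u.
  by rewrite F_move; ring.
rewrite (H_act true) (H_act false) /= mx my -!F_move_eq in e.
have j1 : F x y (x ** (y ** v) ** w) = _ := F_jac cF [:: x] x y y v w.
have j2 : F x y (y ** (x ** v) ** w) = _ := F_jac cF [:: y] x y x v w.
rewrite /= in j1 j2; rewrite j1 j2 !Fjac in e.
linear e.
Qed.

(* [word_functional i phi]: phi is a linear combination of the functionals
   w |-> F x y (a_1 (... (a_i w))) with letters a_j in {x, y}. *)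
Inductive word_functional : nat -> (T -> R) -> Prop :=
| WF_base : word_functional 0 (F x y)
| WF_act i phi b : word_functional i phi ->
    word_functional i.+1 (fun w => phi (lt b ** w))
| WF_add i phi psi : word_functional i phi -> word_functional i psi ->
    word_functional i (fun w => phi w + psi w)
| WF_opp i phi : word_functional i phi -> word_functional i (fun w => - phi w).

Lemma WF_jac i phi a b c : word_functional i phi -> forall D,
  phi (foldr br ((a ** b) ** c) D) =
  phi (foldr br (a ** b ** c) D) - phi (foldr br (b ** a ** c) D).
Proof.
elim=> {i phi} [|i phi d _ IH|i f g _ IH1 _ IH2|i phi _ IH] D.
- exact: (F_jac cF).
- exact: (IH (lt d :: D)).
- by rewrite IH1 IH2; ring.
- by rewrite IH; ring.
Qed.

Lemma WF_anti i phi a b : word_functional i phi -> forall D,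
  phi (foldr br (a ** b) D) = - phi (foldr br (b ** a) D).
Proof.
elim=> {i phi} [|i phi d _ IH|i f g _ IH1 _ IH2|i phi _ IH] D.
- exact: (F_anti cF).
- exact: (IH (lt d :: D)).
- by rewrite IH1 IH2; ring.
- by rewrite IH.
Qed.

(** * Centrality of the squares under a functional, also as rewriting rules *)

Definition central (phi : T -> R) := forall w,
  phi (y ** x ** x ** w) = phi (x ** x ** y ** w) /\
  phi (y ** y ** x ** w) = phi (x ** y ** y ** w).

(** Centrality of xy + yx comes for free: x(xy + yx) - (xy + yx)x = xxy - yxx, and likewise for
    y. *)
Lemma central_swap phi a b c w : central phi ->
  phi (lt a ** lt b ** lt c ** w) + phi (lt b ** lt a ** lt c ** w) =
  phi (lt c ** lt a ** lt b ** w) + phi (lt c ** lt b ** lt a ** w).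
Proof.
by move=> cphi; case: (cphi w) => e1 e2; case: a b c => [] [] [] /=; rewrite ?e1 ?e2; ring.
Qed.

(** The rules move x to the left and serve to normalize words before [ring]; the next two variants
    apply them after up to one or two letters. *)
Lemma central_rules phi w : central phi ->
  (phi (y ** x ** x ** w) = phi (x ** x ** y ** w)) *
  (phi (y ** y ** x ** w) = phi (x ** y ** y ** w)).
Proof. by case/(_ w). Qed.

Lemma central_rules2 phi w : central phi ->
  (forall b, central (fun u => phi (lt b ** u))) ->
  (phi (y ** x ** x ** w) = phi (x ** x ** y ** w)) *
  (phi (y ** y ** x ** w) = phi (x ** y ** y ** w)) *
  (phi (x ** y ** x ** x ** w) = phi (x ** x ** x ** y ** w)) *
  (phi (x ** y ** y ** x ** w) = phi (x ** x ** y ** y ** w)) *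
  (phi (y ** y ** x ** x ** w) = phi (y ** x ** x ** y ** w)) *
  (phi (y ** y ** y ** x ** w) = phi (y ** x ** y ** y ** w)).
Proof.
move=> c0 c1; case: (c0 w) => e1 e2; case: (c1 true w) => /= e3 e4.
by case: (c1 false w) => /= e5 e6.
Qed.

Lemma central_rules3 phi w : central phi ->
  (forall b, central (fun u => phi (lt b ** u))) ->
  (forall a b, central (fun u => phi (lt a ** lt b ** u))) ->
  (phi (y ** x ** x ** w) = phi (x ** x ** y ** w)) *
  (phi (y ** y ** x ** w) = phi (x ** y ** y ** w)) *
  (phi (x ** y ** x ** x ** w) = phi (x ** x ** x ** y ** w)) *
  (phi (x ** y ** y ** x ** w) = phi (x ** x ** y ** y ** w)) *
  (phi (y ** y ** x ** x ** w) = phi (y ** x ** x ** y ** w)) *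
  (phi (y ** y ** y ** x ** w) = phi (y ** x ** y ** y ** w)) *
  (phi (x ** x ** y ** x ** x ** w) = phi (x ** x ** x ** x ** y ** w)) *
  (phi (x ** x ** y ** y ** x ** w) = phi (x ** x ** x ** y ** y ** w)) *
  (phi (x ** y ** y ** x ** x ** w) = phi (x ** y ** x ** x ** y ** w)) *
  (phi (x ** y ** y ** y ** x ** w) = phi (x ** y ** x ** y ** y ** w)) *
  (phi (y ** x ** y ** x ** x ** w) = phi (y ** x ** x ** x ** y ** w)) *
  (phi (y ** x ** y ** y ** x ** w) = phi (y ** x ** x ** y ** y ** w)) *
  (phi (y ** y ** y ** x ** x ** w) = phi (y ** y ** x ** x ** y ** w)) *
  (phi (y ** y ** y ** y ** x ** w) = phi (y ** y ** x ** y ** y ** w)).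
Proof.
move=> c0 c1 c2; have r2 := central_rules2 w c0 c1.
case: (c2 true true w) (c2 true false w) (c2 false true w) (c2 false false w).
by move=> /= ? ? [? ?] [? ?] [? ?]; do !split; rewrite ?r2.
Qed.

(* Acting by z = xy - yx, [defect phi b w] is phi (b z w) + phi (z b w). *)
Definition defect (phi : T -> R) b w :=
  if b then phi (x ** x ** y ** w) - phi (y ** x ** x ** w)
  else phi (x ** y ** y ** w) - phi (y ** y ** x ** w).

Lemma centralP phi : (forall b w, defect phi b w = 0) -> central phi.
Proof.
move=> dphi w; have /= := (dphi true w, dphi false w).
by case=> /subr0_eq e1 /subr0_eq e2.
Qed.

(* The action on [phi] of the product of the elements ab + ba over the successive
   pairs of letters of [D], up to the scalar 2 = -1 per pair. *)
Fixpoint beta (phi : T -> R) (D : seq bool) : T -> R :=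
  if D is a :: b :: D' then
    fun w => - (beta phi D' (lt a ** lt b ** w) + beta phi D' (lt b ** lt a ** w))
  else phi.

Lemma pair_ind (P : seq bool -> Prop) : P [::] ->
  (forall a b D, ~~ odd (size D) -> P D -> P [:: a, b & D]) ->
  forall D, ~~ odd (size D) -> P D.
Proof.
move=> P0 PS D; have [n] := ubnP (size D).
elim: n D => // n IH [|a [|b D]] //= lt_n; rewrite negbK => evD.
by apply: PS => //; apply: IH => //; exact: ltnW.
Qed.

Lemma WF_beta i phi D : ~~ odd (size D) -> word_functional i phi ->
  word_functional (size D + i) (beta phi D).
Proof.
move=> evD wphi; elim/pair_ind: D / evD => //= a b D evD IH.
by apply/WF_opp/WF_add; [exact: WF_act b (WF_act a IH) | exact: WF_act a (WF_act b IH)].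
Qed.

(** * Centrality at level m, given centrality below m *)

Section Level.
Variable m : nat.
Hypothesis IHm : forall i phi, (i < m)%N -> word_functional i phi -> central phi.

(** Below level m the factors ab + ba commute with c by [central_swap]. *)
Lemma beta_act i phi c D w : ~~ odd (size D) -> (i + size D < m)%N ->
  word_functional i phi ->
  beta (fun u => phi (lt c ** u)) D w = beta phi D (lt c ** w).
Proof.
move=> evD ltm wphi; elim/pair_ind: D / evD w ltm => //= a b D evD IH w ltm.
rewrite !IH; try by apply: leq_ltn_trans ltm; rewrite leq_add2l !leqW.
rewrite (@central_swap _ a b c) //; apply: IHm (WF_beta evD wphi).
by apply: leq_ltn_trans ltm; rewrite addnC leq_add2l !leqW.
Qed.

Lemma WF_comm i phi D w : word_functional i phi ->
  phi (word D ((x ** y) ** w)) =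
  phi (word D (x ** y ** w)) - phi (word D (y ** x ** w)).
Proof. by move=> wphi; rewrite /lword (WF_jac _ _ _ wphi). Qed.

(** Here u is meant to be D z. If z anticommutes with the letters, then [a, [c, z]] = 2(ac + ca)z =
    -(ac + ca)z modulo 3, so an even word acts as the factors of [beta] followed by z; an odd one
    ends in [c, z] instead. *)
Definition even_spec D u :=
  [/\ forall b w, F (lt b) u w = beta (F x y) D (lt b ** w),
      forall w, H x u y w = - beta (F x y) D ((x ** y) ** w) &
      forall i phi w, word_functional i phi -> (i + size D <= m)%N ->
        phi (u ** w) = beta phi D ((x ** y) ** w)].

Definition odd_spec c D u :=
  [/\ forall b w, F (lt b) u w =
        - (beta (F x y) D (lt b ** lt c ** w) + beta (F x y) D (lt c ** lt b ** w)),
      forall w, H x u y w = 0 &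
      forall i phi w, word_functional i phi -> (i + size D < m)%N ->
        phi (u ** w) = beta phi D (lt c ** (x ** y) ** w)
          - beta phi D ((x ** y) ** lt c ** w)].

Lemma even_spec_nil : even_spec [::] (x ** y).
Proof.
split=> [[] w|w|] //=.
- by rewrite F_move_eq.
- by rewrite -Fcyc Fanti Fcyc -F_move_eq sw12 opprK.
- by rewrite H_split (dbl (r := F (x ** y) (x ** y) w)) ?subr0 // {1}sw12 addNr.
Qed.

Lemma odd_of_even c D u : ~~ odd (size D) -> (size D < m)%N ->
  even_spec D u -> odd_spec c D (lt c ** u).
Proof.
move=> evD ltm [e1 e2 e3].
have wpsi := WF_beta evD WF_base; have cpsi := IHm _ wpsi.
rewrite addn0 in cpsi; have {}cpsi := cpsi ltm.
split=> [b w|w|i phi w wphi leim].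
- have := F_move (lt c) u (lt b) w; rewrite e1.
  case: b c => [] [] /=; rewrite ?H_eq13 ?(H_swap13 x) ?e2 ?(WF_comm [::] _ wpsi) /= => e;
    linear3 (2 :* e).
- have e4 : F x y (lt c ** u ** w) = beta (F x y) D (lt c ** (x ** y) ** w).
    rewrite (e3 _ _ _ (WF_act c WF_base)) ?add1n //.
    by rewrite (beta_act _ _ evD _ WF_base).
  rewrite H_act (e1 true) (e1 false) e4 (e3 _ _ _ WF_base) 1?ltnW //.
  rewrite (WF_comm [:: c] _ wpsi) (WF_comm [::] _ wpsi) /=.
  by case: c {e4} => /=; case: (cpsi w) => e5 e6; rewrite ?e5 ?e6; ring.
- rewrite (WF_jac _ _ _ wphi [::]) /=.
  rewrite (e3 _ _ _ (WF_act c wphi)) ?addSn // (e3 _ _ _ wphi) 1?ltnW //.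
  by rewrite (beta_act _ _ evD _ wphi).
Qed.

Lemma even_of_odd a c D u : ~~ odd (size D) -> ((size D).+1 < m)%N ->
  odd_spec c D u -> even_spec [:: a, c & D] (lt a ** u).
Proof.
move=> evD ltm [o1 o2 o3].
have wpsi i phi : word_functional i phi -> (i + size D < m)%N -> central (beta phi D).
  by move=> wphi lti; apply: IHm (WF_beta evD wphi); rewrite addnC.
have wpsi1 i phi b : word_functional i phi -> ((i + size D).+1 < m)%N ->
    central (fun w => beta phi D (lt b ** w)).
  by move=> wphi lti; apply: IHm (WF_act b (WF_beta evD wphi)); rewrite addnC.
split=> [b w|w|i phi w wphi]; last rewrite !addnS => leim; rewrite /=.
- have := F_move (lt a) u (lt b) w; rewrite o1.
  have -> : H (lt a) u (lt b) w = 0.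
    by case: a b => [] [] /=; rewrite ?H_eq13 ?(H_swap13 x) ?o2 ?oppr0.
  by rewrite addr0 => <-.
- rewrite H_act (o1 true) (o1 false) (o3 _ _ _ WF_base) 1?ltnW //.
  rewrite (o3 _ _ _ (WF_act a WF_base)) ?add1n //.
  rewrite !(beta_act _ _ evD _ WF_base) 1?ltnW //.
  have wp := WF_beta evD WF_base.
  have jac := WF_comm _ _ wp.
  rewrite (jac [:: a; c]) (jac [:: c; a]) (jac [:: a]) (jac [:: c]) (jac [::]) /=.
  have N v := central_rules2 v (wpsi _ _ WF_base (ltnW ltm))
    (fun b => wpsi1 _ _ b WF_base ltm).
  by case: a c {o1 o2 o3 jac} => [] [] /=; rewrite ?N; ring3.
- rewrite (WF_jac _ _ _ wphi [::]) /= (o3 _ _ _ wphi) 1?ltnW //.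
  rewrite (o3 _ _ _ (WF_act a wphi)) // !(beta_act _ _ evD _ wphi) 1?ltnW //.
  have jac := WF_comm _ _ (WF_beta evD wphi).
  rewrite (jac [:: a; c]) (jac [:: c; a]) (jac [:: a]) (jac [:: c]) (jac [::]) /=.
  have N v := central_rules2 v (wpsi _ _ wphi (ltnW leim)) (fun b => wpsi1 _ _ b wphi leim).
  by case: a c {o1 o2 o3 jac} => [] [] /=; rewrite ?N; ring3.
Qed.

Lemma even_specP D : ~~ odd (size D) -> (size D <= m)%N ->
  even_spec D (word D (x ** y)).
Proof.
move=> evD; elim/pair_ind: D / evD => [_|a c D evD IH lem]; first exact: even_spec_nil.
apply: even_of_odd => //; apply: odd_of_even => //; first exact: ltnW lem.
by apply: IH; exact: ltnW (ltnW lem).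
Qed.

Lemma odd_specP c D : ~~ odd (size D) -> (size D < m)%N ->
  odd_spec c D (word (c :: D) (x ** y)).
Proof. by move=> evD ltm; apply: odd_of_even => //; exact: even_specP evD (ltnW ltm). Qed.

(* The commutator of ab + ba with v, acting on [phi]. *)
Definition comm_sym phi a b v w : R :=
  phi (lt a ** lt b ** v ** w) + phi (lt b ** lt a ** v ** w)
  - phi (v ** lt a ** lt b ** w) - phi (v ** lt b ** lt a ** w).

Lemma comm_sym_act i phi a b c v w : word_functional i phi -> central phi ->
  comm_sym phi a b (lt c ** v) w =
  comm_sym (fun u => phi (lt c ** u)) a b v w - comm_sym phi a b v (lt c ** w)
  + phi (v ** lt c ** lt a ** lt b ** w) + phi (v ** lt c ** lt b ** lt a ** w)
  - phi (v ** lt a ** lt b ** lt c ** w) - phi (v ** lt b ** lt a ** lt c ** w).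
Proof.
move=> wphi cphi; rewrite /comm_sym.
have jac := WF_jac _ _ _ wphi.
rewrite (jac _ _ _ [:: lt a; lt b]) (jac _ _ _ [:: lt b; lt a]) !(jac _ _ _ [::]) /=.
linear (central_swap a b c (v ** w) cphi).
Qed.

Lemma comm_sym_odd i phi a b c D w : ~~ odd (size D) -> (i.+1 + size D < m)%N ->
  (forall j psi u, (j + size D < m)%N -> word_functional j psi ->
     comm_sym psi a b (word D (x ** y)) u = comm_sym (beta psi D) a b (x ** y) u) ->
  word_functional i phi ->
  comm_sym phi a b (word (c :: D) (x ** y)) w =
  comm_sym (fun u => beta phi D (lt c ** u)) a b (x ** y) w
  - comm_sym (beta phi D) a b (x ** y) (lt c ** w)
  + beta phi D ((x ** y) ** lt c ** lt a ** lt b ** w)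
  + beta phi D ((x ** y) ** lt c ** lt b ** lt a ** w)
  - beta phi D ((x ** y) ** lt a ** lt b ** lt c ** w)
  - beta phi D ((x ** y) ** lt b ** lt a ** lt c ** w).
Proof.
move=> evD ltm IH wphi.
have ltm' : (i + size D < m)%N by rewrite addSn in ltm; exact: ltnW.
have lem : (size D <= m)%N by apply: leq_trans (ltnW ltm'); exact: leq_addl.
have lti : (i < m)%N by apply: leq_ltn_trans ltm'; exact: leq_addr.
have [_ _ e3] := even_specP evD lem.
rewrite (comm_sym_act _ _ _ _ _ wphi (IHm lti wphi)).
rewrite (IH _ _ _ ltm (WF_act c wphi)) (IH _ _ _ ltm' wphi).
rewrite !(e3 _ _ _ wphi (ltnW ltm')) /comm_sym.
by rewrite !(beta_act _ _ evD _ wphi).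
Qed.

Lemma comm_sym_even a b D : ~~ odd (size D) -> forall i phi w,
  (i + size D < m)%N -> word_functional i phi ->
  comm_sym phi a b (word D (x ** y)) w = comm_sym (beta phi D) a b (x ** y) w.
Proof.
move=> evD; elim/pair_ind: D / evD => // d c D evD IH i phi w.
rewrite !addnS => ltm wphi.
have ltm1 : ((i + size D).+1 < m)%N by exact: ltnW.
have ltm0 : (i + size D < m)%N by exact: ltnW.
have lti : (i < m)%N by apply: leq_ltn_trans ltm0; exact: leq_addr.
have ltD : (size D < m)%N by apply: leq_ltn_trans ltm0; exact: leq_addl.
have [_ _ o3] := odd_specP c evD ltD.
rewrite (comm_sym_act _ _ _ _ _ wphi (IHm lti wphi)).
rewrite (comm_sym_odd _ _ evD _ IH (WF_act d wphi)) //.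
rewrite (comm_sym_odd _ _ evD _ IH wphi) ?addSn // !(o3 _ _ _ wphi ltm0).
rewrite /comm_sym /= !(beta_act _ _ evD _ wphi) //.
have wpsi := WF_beta evD wphi.
have jac := WF_comm _ _ wpsi.
have J0 v := jac [::] v.
have J1 p v := jac [:: p] v.
have J2 p q v := jac [:: p; q] v.
have J3 p q r v := jac [:: p; q; r] v.
have J4 p q r s v := jac [:: p; q; r; s] v.
rewrite /= in J0 J1 J2 J3 J4.
rewrite addnC in ltm ltm1 ltm0.
(* Both sides are now combinations of words under [beta phi D]; the bounds on the level permit the
   rules after zero, one or two letters. *)
have N v := central_rules3 v (IHm ltm0 wpsi) (fun e => IHm ltm1 (WF_act e wpsi))
  (fun e f => IHm ltm (WF_act f (WF_act e wpsi))).
rewrite !(J4, J3, J2, J1, J0) {IH J4 J3 J2 J1 J0 jac o3}.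
by case: a b c d => [] [] [] []; rewrite /lword /= ?N; ring3.
Qed.

(** This raises the level: for v a word, the defects belong to longer functionals than those in
    [comm_sym]. *)
Lemma relation a b v w :
  defect (F (lt a) v) b w + defect (F (lt b) v) a w
  + comm_sym (F x y) a b v w = 0.
Proof.
rewrite /comm_sym; have e1 := sq_relation x y v w.
have := sq_relation y x v w; rewrite !(sw12 x y) => e2.
have e3 := cross_relation v w.
case: a b => [] [] /=; [linear (2 :* e1)|linear e3|linear e3|linear (-2 :* e2)].
Qed.

(** [relation] at v = D z: [even_specP] identifies its defects with those at level m, and
    [comm_sym_even] replaces v by z in the other term. *)
Lemma central_odd b D : ~~ odd (size D) -> (size D).+1 = m ->
  central (fun w => beta (F x y) D (lt b ** w)).
Proof.
move=> evD sDm; have ltm : (size D < m)%N by rewrite -sDm.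
have [e1 _ _] := even_specP evD (ltnW ltm).
have wpsi := WF_beta evD WF_base; rewrite addn0 in wpsi.
have jac := WF_comm _ _ wpsi.
have rel p q w : defect (fun u => beta (F x y) D (lt p ** u)) q w
    + defect (fun u => beta (F x y) D (lt q ** u)) p w
    + comm_sym (beta (F x y) D) p q (x ** y) w = 0.
  rewrite -(@comm_sym_even p q D evD 0 _ w ltm WF_base) -(relation p q (word D (x ** y)) w).
  by rewrite /defect !e1.
have N v := central_rules v (IHm ltm wpsi).
apply: centralP => d w; move: (rel true true w) (rel true false w) (rel false false w).
rewrite /comm_sym /= (jac [:: true; true]) (jac [:: true; false]) (jac [:: false; true]).
rewrite (jac [:: false; false]) !(jac [::]) /lword /= !N => r1 r2 r3.
by case: b d => [] [] /=; rewrite ?N; [linear3 r1|linear3 r2|linear3 r2|linear3 r3].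
Qed.

(** Same method with v the odd word e D z, through [odd_specP] and [comm_sym_odd]; the six relations
    determine all defects. *)
Lemma central_even b c D : ~~ odd (size D) -> (size D).+2 = m ->
  central (fun w => beta (F x y) D (lt b ** lt c ** w)).
Proof.
move=> evD sDm; have ltm1 : ((size D).+1 < m)%N by rewrite -sDm.
have ltm := ltnW ltm1.
have o1 e := let: And3 o1 _ _ := odd_specP e evD ltm in o1.
have wpsi := WF_beta evD WF_base; rewrite addn0 in wpsi.
have jac := WF_comm _ _ wpsi.
have rel p q e w := relation p q (word (e :: D) (x ** y)) w.
have N v := central_rules2 v (IHm ltm wpsi) (fun e => IHm ltm1 (WF_act e wpsi)).
have J0 v := jac [::] v.
have J1 p v := jac [:: p] v.
have J2 p q v := jac [:: p; q] v.
have J3 p q r v := jac [:: p; q; r] v.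
rewrite /lword /= in J0 J1 J2 J3.
have K := comm_sym_odd _ _ evD _ (fun j psi u => comm_sym_even _ _ evD u) WF_base.
have {}rel p q e w : defect (fun u => - (beta (F x y) D (lt p ** lt e ** u)
       + beta (F x y) D (lt e ** lt p ** u))) q w
    + defect (fun u => - (beta (F x y) D (lt q ** lt e ** u)
       + beta (F x y) D (lt e ** lt q ** u))) p w
    + (comm_sym (fun u => beta (F x y) D (lt e ** u)) p q (x ** y) w
  - comm_sym (beta (F x y) D) p q (x ** y) (lt e ** w)
  + beta (F x y) D ((x ** y) ** lt e ** lt p ** lt q ** w)
  + beta (F x y) D ((x ** y) ** lt e ** lt q ** lt p ** w)
  - beta (F x y) D ((x ** y) ** lt p ** lt q ** lt e ** w)
  - beta (F x y) D ((x ** y) ** lt q ** lt p ** lt e ** w)) = 0.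
  by rewrite -K // -(rel p q e w) /defect !o1.
apply: centralP => d w.
move: (rel true true true w) (rel true true false w) (rel true false true w)
  (rel true false false w) (rel false false true w) (rel false false false w).
rewrite /comm_sym !(J3, J2, J1, J0) /= !N => r1 r2 r3 r4 r5 r6.
case: b c d => [] [] [] /=; rewrite ?N; [linear3 r1|linear3 (2 :* (r2 :+ r3))|..].
- linear3 (2 :* (r2 :+ r3)).
- linear3 r4.
- linear3 r3.
- linear3 (2 :* (r4 :+ r5)).
- linear3 (2 :* (r4 :+ r5)).
- linear3 r6.
Qed.

(** [H_adx2] expanded by [H_act]; in the case of y, yyx is first turned into -yxy by
    anticommutativity. *)
Lemma central_base : central (F x y).
Proof.
apply: centralP => b w.
have hx := H_adx2 x y w; have hy := H_adx2 y x w.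
have a1 : F (y ** y ** x ** y) x w = - F (y ** y ** y ** x) x w.
  by rewrite !(Fcyc _ x w); exact: (F_anti cF [:: y; y]).
have a2 : F (x ** w) y (y ** x ** y) = - F (x ** w) y (y ** y ** x).
  exact: (F_anti cF [:: y]).
have {hy} : H x (y ** x ** y) y w = 0.
  by rewrite H_swap13; rewrite /H in hy *; linear (hy :- a1 :- a2).
move: hx; have [o1 _ _] := even_spec_nil.
rewrite (H_act true) (H_act false) !(o1 true) !(o1 false) /= !Fjac.
rewrite (F_jac cF [:: x]) (F_jac cF [:: y]) /= => e1 e2.
by case: b => /=; [linear3 (2 :* e1)|linear3 (2 :* e2)].
Qed.

(** Pairs of letters of r are absorbed into D. Modulo the rules known below level m, the elements
    (pq + qp)e span all words of three letters. *)
Lemma central_word D r : ~~ odd (size D) -> (size D + size r)%N = m ->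
  central (fun w => beta (F x y) D (word r w)).
Proof.
have [n] := ubnP (size r); elim: n r D => // n IH [|a [|b [|c r]]] D lt_n evD /= sz.
- case: D evD sz {lt_n} => [|p [|q D]] //=; rewrite addn0 => evD sz.
    exact: central_base.
  rewrite negbK in evD.
  have c1 := central_even p q evD sz; have c2 := central_even q p evD sz.
  by move=> w; case: (c1 w) (c2 w) => /= -> -> [-> ->].
- by apply: central_odd => //; rewrite -sz addn1.
- by apply: central_even => //; rewrite -sz addn2.
have wpsi := WF_beta evD WF_base; rewrite addn0 in wpsi.
have ltm : (size D < m)%N by rewrite -sz -[X in (X < _)%N]addn0 ltn_add2l.
have N v := central_rules v (IHm ltm wpsi).
have S p q e : central (fun w => beta (F x y) [:: p, q & D] (lt e ** word r w)).
  apply: (IH (e :: r)); [exact: ltnW lt_n|by rewrite /= negbK|].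
  by rewrite -sz /= !addnS !addSn.
move=> w; move: (S true true true w) (S true true false w) (S true false true w).
move: (S true false false w) (S false false true w) (S false false false w).
rewrite /= ?N => -[xyy xyy'] [yyx yyx'] [yyy yyy'] [xxx xxx'] [xxy xxy'] [xyx xyx'].
case: a b c {S lt_n sz} => [] [] []; rewrite /= ?N.
- by split; [linear3 xxx|linear3 xxx'].
- by split; [linear3 xxy|linear3 xxy'].
- by split; [linear3 (2 :* xyx :- xxy)|linear3 (2 :* xyx' :- xxy')].
- by split; [linear3 yyx|linear3 yyx'].
- by split; [linear3 xxy|linear3 xxy'].
- by split; [linear3 (2 :* xyy :- yyx)|linear3 (2 :* xyy' :- yyx')].
- by split; [linear3 yyx|linear3 yyx'].
- by split; [linear3 yyy|linear3 yyy'].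
Qed.

Lemma central_level phi : word_functional m phi -> central phi.
Proof.
suff gen i psi : word_functional i psi -> forall r, (i + size r)%N = m ->
    central (fun w => psi (word r w)).
  by move=> wphi; exact: (gen m phi wphi [::] (addn0 m)).
elim=> {i psi} [r szr|i psi b _ IH r szr|i f g _ IH1 _ IH2 r szr w|i f _ IH r szr w].
- exact: (@central_word [::]).
- by apply: (IH (b :: r)); rewrite -szr /= addnS addSn.
- by case: (IH1 r szr w) (IH2 r szr w) => -> -> [-> ->].
- by case: (IH r szr w) => -> ->.
Qed.

End Level.

(** * Conclusion in characteristic 3 *)

Lemma centralT i phi : word_functional i phi -> central phi.
Proof.
have [n] := ubnP i; elim: n i phi => // n IH i phi lt_i wphi.
apply: (@central_level i) => // j psi ltj wpsi.
by apply: IH wpsi; apply: leq_trans ltj _.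
Qed.

Lemma word_anticomm i phi D : word_functional i phi ->
  phi ((x ** y) ** word D (x ** y)) = 0.
Proof.
elim: D i phi => [|b D IH] i phi wphi /=.
  by apply: dbl; rewrite {1}(WF_anti _ _ wphi [::]) addNr.
have := IH _ _ (WF_act b wphi); have := centralT wphi.
move=> /(_ (word D (x ** y)))[e1 e2].
rewrite (WF_comm [:: b] _ wphi) (WF_comm [::] _ wphi) /=.
by case: b => /= e; [linear (-1 :* (e1 :+ e))|linear (-1 :* (e2 :+ e))].
Qed.

Lemma H_words3 D E : H x (word D (x ** y)) y (word E (x ** y)) = 0.
Proof.
have wlam D' : ~~ odd (size D') -> word_functional (size D') (beta (F x y) D').
  by move=> evD; have := WF_beta evD WF_base; rewrite addn0.
have cT m i phi : (i < m)%N -> word_functional i phi -> central phi.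
  by move=> _; exact: centralT.
have [oD|evD] := boolP (odd (size D)); last first.
  have [_ -> _] := even_specP (cT _) evD (leqnn _).
  by rewrite (word_anticomm _ (wlam _ evD)) oppr0.
case: D oD => // c D evD; have [_ -> _] := odd_specP (cT _) c evD (ltnSn _).
by [].
Qed.

Lemma F_comm3 D E : F x y (word D ((x ** y) ** word E (x ** y))) = 0.
Proof.
suff gen i phi : word_functional i phi ->
    phi (word D ((x ** y) ** word E (x ** y))) = 0 by exact: gen WF_base.
elim: D i phi => [|b D IH] i phi wphi; first exact: word_anticomm wphi.
exact: IH (WF_act b wphi).
Qed.

End Pair.
End Char3.
End Form.

(** * The form of a nonassociative algebra *)

(* Leaves: the two generators, and [None] for their sum. *)
Inductive tree := Leaf of option bool | Node of tree & tree.

Fixpoint deg t := if t is Node u v then (deg u + deg v)%N else 1%N.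

Lemma deg_gt0 t : (0 < deg t)%N.
Proof. by elim: t => //= u IHu v _; rewrite addn_gt0 IHu. Qed.

Section Algebra.
Context (K : fieldType) (V : lmodType K) (m : V -> V -> V).
Hypothesis bil : bilinear_mul m.
Local Notation leib := (leib m).
Local Notation "a ** b" := (m a b) (at level 38, right associativity).

Definition emb (v : V) : trivext V := (0, v).

Lemma emb_inj : injective emb. Proof. by move=> v w []. Qed.
Lemma embD v w : emb (v + w) = emb v + emb w.
Proof. by congr pair; rewrite /= addr0. Qed.
Lemma embN v : emb (- v) = - emb v.
Proof. by congr pair; rewrite /= oppr0. Qed.
Lemma emb0 : emb 0 = 0. Proof. by []. Qed.

Ltac vring := apply: emb_inj; rewrite ?(embD, embN, emb0); ring.
Ltac vlinear e := apply: emb_inj; move: e;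
  rewrite ?(embD, embN, emb0) => /lincomb; apply; ring.
Local Notation "!! e" := (congr1 emb e) (at level 35).

Lemma mulDl a b c : (a + b) ** c = a ** c + b ** c.
Proof. by have := bil.1 1 a b c; rewrite !scale1r. Qed.
Lemma mulDr a b c : a ** (b + c) = a ** b + a ** c.
Proof. by have := bil.2 1 a b c; rewrite !scale1r. Qed.
Lemma mul0l a : 0 ** a = 0.
Proof. by have /eqP := mulDl 0 0 a; rewrite addr0 -subr_eq0 opprD addNKr oppr_eq0 => /eqP. Qed.
Lemma mul0r a : a ** 0 = 0.
Proof. by have /eqP := mulDr a 0 0; rewrite addr0 -subr_eq0 opprD addNKr oppr_eq0 => /eqP. Qed.
Lemma mulNl a b : (- a) ** b = - (a ** b).
Proof. by apply/eqP; rewrite -addr_eq0 -mulDl addNr mul0l. Qed.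
Lemma mulNr a b : a ** (- b) = - (a ** b).
Proof. by apply/eqP; rewrite -addr_eq0 -mulDr addNr mul0r. Qed.

Lemma leibD1 a a' b c : leib (a + a') b c = leib a b c + leib a' b c.
Proof. rewrite /Defs.leib !(mulDl, mulDr); vring. Qed.
Lemma leibD2 a b b' c : leib a (b + b') c = leib a b c + leib a b' c.
Proof. rewrite /Defs.leib !(mulDl, mulDr); vring. Qed.
Lemma leibD3 a b c c' : leib a b (c + c') = leib a b c + leib a b c'.
Proof. rewrite /Defs.leib !(mulDl, mulDr); vring. Qed.

Lemma embZ k v : emb (k *: v) = ((k, 0) : trivext V) * emb v.
Proof. by congr pair; rewrite /= ?mulr0 // scaler0 addr0. Qed.

Lemma leib_lin1 k a a' b c : leib (k *: a + a') b c = k *: leib a b c + leib a' b c.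
Proof. rewrite /Defs.leib !(bil.1, bil.2); apply: emb_inj; rewrite !(embD, embN, embZ); ring. Qed.
Lemma leib_lin2 k a b b' c : leib a (k *: b + b') c = k *: leib a b c + leib a b' c.
Proof. rewrite /Defs.leib !(bil.1, bil.2); apply: emb_inj; rewrite !(embD, embN, embZ); ring. Qed.
Lemma leib_lin3 k a b c c' : leib a b (k *: c + c') = k *: leib a b c + leib a b c'.
Proof. rewrite /Defs.leib !(bil.1, bil.2); apply: emb_inj; rewrite !(embD, embN, embZ); ring. Qed.

(** * Consequences of the three identities *)

Section Identities.
Hypothesis leib_aab : forall a b, leib a a b = 0.
Hypothesis leib_aba : forall a b, leib a b a = 0.
Hypothesis leib_abab : forall a b, leib a b (a ** b) = 0.

Lemma leib_swap12 a b c : leib b a c = - leib a b c.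
Proof.
have := leib_aab (a + b) c; rewrite !(leibD1, leibD2) !leib_aab => e; vlinear (!! e).
Qed.

Lemma leib_swap13 a b c : leib c b a = - leib a b c.
Proof.
have := leib_aba (a + c) b; rewrite !(leibD1, leibD3) !leib_aba => e; vlinear (!! e).
Qed.

Lemma leib_swap23 a b c : leib a c b = - leib a b c.
Proof. by rewrite leib_swap12 leib_swap13 leib_swap12 opprK. Qed.

Lemma leib_cyc a b c : leib a b c = leib b c a.
Proof. by rewrite leib_swap12 leib_swap23 opprK. Qed.

(** Linearization of [leib_abab] in both variables. *)
Lemma leib_bin a b c d : leib (a ** b) c d + leib (c ** b) a d
  + leib (a ** d) c b + leib (c ** d) a b = 0.
Proof.
have Q u v w : leib u w (v ** w) + leib v w (u ** w) = 0.
  have := leib_abab (u + v) w.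
  rewrite mulDl !(leibD1, leibD3) !leib_abab => e; vlinear (!! e).
have := Q a c (b + d); have := Q a c b; have := Q a c d.
rewrite !mulDr !(leibD2, leibD3) !(leib_cyc (_ ** _)) => e1 e2 e3.
vlinear (!! e3 :- !! e2 :- !! e1).
Qed.

Lemma anti_ann a b c : (a ** b) ** c = - ((b ** a) ** c).
Proof.
have sq u v : (u ** u) ** v = 0 by have := leib_aab u v; rewrite /Defs.leib subrK.
have := sq (a + b) c; rewrite !(mulDl, mulDr) !sq => e; vlinear (!! e).
Qed.

(** Up to alternation of [leib] and [anti_ann], the left side is a<b,c,d> + b<c,a,d> + c<a,b,d> +
    <a,b,c>d, where <a,b,c> is [leib a b c]. *)
Lemma leib_cocyc a b c d :
  leib b c d = 0 -> leib c a d = 0 -> leib a b d = 0 -> leib a b c = 0 ->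
  leib (a ** b) c d + leib (c ** d) a b + leib (b ** c) a d + leib (a ** d) b c
  + leib (c ** a) b d + leib (b ** d) c a = 0.
Proof.
move=> /(congr1 (m a)) h1 /(congr1 (m b)) h2 /(congr1 (m c)) h3 /(congr1 (m^~ d)) h4.
have n1 := anti_ann c (a ** b) d.
have n2 : (b ** (c ** a)) ** d = - ((b ** (a ** c)) ** d).
  by rewrite anti_ann (anti_ann c a) mulNl -anti_ann.
rewrite (leib_swap12 c (a ** b)) (leib_swap12 a (b ** c)) (leib_swap12 b (c ** a)).
rewrite (leib_cyc (c ** d)) (leib_cyc (a ** d)) (leib_cyc (b ** d)).
move: h1 h2 h3 h4; rewrite /Defs.leib !(mulDl, mulDr, mulNl, mulNr, mul0l, mul0r).
move=> h1 h2 h3 h4.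
vlinear (!! h1 :+ !! h2 :+ !! h3 :+ !! h4 :- !! n1 :- !! n2).
Qed.

(** * Induction on the degree of monomials *)

Section Trees.
Variables (g1 g2 : V) (n : nat).
Hypothesis two_neq0 : (2%:R : K) != 0.

Fixpoint ev t :=
  match t with
  | Leaf (Some true) => g1
  | Leaf (Some false) => g2
  | Leaf None => g1 + g2
  | Node u v => ev u ** ev v
  end.

(** The cut-off to degree n makes the laws of [cocycle], some of which rest on vanishing below
    degree n, hold for all trees. *)
Definition leib_deg u v w : trivext V :=
  if (deg u + deg v + deg w == n)%N then emb (leib (ev u) (ev v) (ev w)) else 0.

Hypothesis leib_lt : forall u v w, (deg u + deg v + deg w < n)%N ->
  leib (ev u) (ev v) (ev w) = 0.

Lemma ev_foldr D t : ev (foldr Node t D) = foldr m (ev t) (map ev D).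
Proof. by elim: D => //= d D ->. Qed.

Lemma deg_foldr D t : deg (foldr Node t D) = (sumn (map deg D) + deg t)%N.
Proof. by elim: D => //= d D ->; rewrite addnA. Qed.

Lemma foldr_mulD D v w : foldr m (v + w) D = foldr m v D + foldr m w D.
Proof. by elim: D => //= d D ->; rewrite mulDr. Qed.

Lemma foldr_mulN D v : foldr m (- v) D = - foldr m v D.
Proof. by elim: D => //= d D ->; rewrite mulNr. Qed.

(** If q annihilates everything from the left, then leib q c d = 0 while leib c q d = (cq)d. For q =
    ab + ba this leads to [F_anti]. *)
Lemma foldr_ann D q : (forall d, q ** d = 0) -> forall d, foldr m q D ** d = 0.
Proof.
move=> q0; elim: D => //= c D IH d.
have := leib_swap12 (foldr m q D) c d; rewrite /Defs.leib !IH !(mul0l, mul0r).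
by rewrite !subr0 !addr0 oppr0.
Qed.

Lemma leib_ann u v q : (forall d, q ** d = 0) -> leib u v q = 0.
Proof. by move=> q0; rewrite -leib_cyc /Defs.leib !q0 !(mul0l, mul0r) subr0 addr0. Qed.

Lemma leibN3 a b c : leib a b (- c) = - leib a b c.
Proof. by apply/eqP; rewrite -addr_eq0 -leibD3 addNr leib_ann // => d; rewrite mul0l. Qed.

Lemma leib_deg_cocycle : cocycle Node leib_deg.
Proof.
split.
- move=> [k v] []; rewrite -!mulr2n -mulr_natl -scaler_nat.
  move=> /eqP; rewrite mulf_eq0 (negPf two_neq0) => /eqP -> /eqP.
  by rewrite scaler_eq0 (negPf two_neq0) => /eqP ->.
- move=> u v w; rewrite /leib_deg (addnC (deg v)); case: eqP => _; last by rewrite oppr0.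
  by rewrite leib_swap12 embN.
- move=> u v w; rewrite /leib_deg addnAC; case: eqP => _; last by rewrite oppr0.
  by rewrite leib_swap23 embN.
- move=> a b c d; rewrite /leib_deg /=.
  rewrite (_ : (deg c + deg b + deg a + deg d)%N = (deg a + deg b + deg c + deg d)%N); last by ring.
  rewrite (_ : (deg a + deg d + deg c + deg b)%N = (deg a + deg b + deg c + deg d)%N); last by ring.
  rewrite (_ : (deg c + deg d + deg a + deg b)%N = (deg a + deg b + deg c + deg d)%N); last by ring.
  case: eqP => _; last by rewrite !addr0.
  by rewrite -!embD leib_bin.
- move=> a b c d; rewrite /leib_deg /=.
  rewrite (_ : (deg c + deg d + deg a + deg b)%N = (deg a + deg b + deg c + deg d)%N); last by ring.
  rewrite (_ : (deg b + deg c + deg a + deg d)%N = (deg a + deg b + deg c + deg d)%N); last by ring.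
  rewrite (_ : (deg a + deg d + deg b + deg c)%N = (deg a + deg b + deg c + deg d)%N); last by ring.
  rewrite (_ : (deg c + deg a + deg b + deg d)%N = (deg a + deg b + deg c + deg d)%N); last by ring.
  rewrite (_ : (deg b + deg d + deg c + deg a)%N = (deg a + deg b + deg c + deg d)%N); last by ring.
  case: eqP => [dn|_]; last by rewrite !addr0.
  have lt3 k l : (k + deg l = n)%N -> (k < n)%N by move=> <-; rewrite -addn1 leq_add2l deg_gt0.
  rewrite -!embD leib_cocyc //; apply: leib_lt.
  + by apply: (lt3 _ a); rewrite -dn; ring.
  + by apply: (lt3 _ b); rewrite -dn; ring.
  + by apply: (lt3 _ c); rewrite -dn; ring.
  + by apply: (lt3 _ d).
- move=> D u v a b c; rewrite /leib_deg !deg_foldr !ev_foldr /=.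
  rewrite (_ : (deg b + (deg a + deg c))%N = (deg a + deg b + deg c)%N); last by ring.
  rewrite (addnA (deg a) (deg b)); case: eqP => [dn|_]; last by rewrite subr0.
  (* u and v have positive degree, so the inner triple lies below degree n. *)
  have /leib_lt : (deg a + deg b + deg c < n)%N.
    rewrite -dn addnA -[X in (X < _)%N]add0n ltn_add2r.
    by rewrite !addn_gt0 deg_gt0.
  rewrite {1}/Defs.leib -addrA => /eqP; rewrite addr_eq0 opprD opprK => /eqP ->.
  by rewrite foldr_mulD foldr_mulN leibD3 leibN3 embD embN.
- move=> D u v a b; rewrite /leib_deg !deg_foldr !ev_foldr /= (addnC (deg b)).
  case: eqP => _; last by rewrite oppr0.
  rewrite -embN; congr emb; apply/eqP; rewrite -addr_eq0 -leibD3 -foldr_mulD.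
  rewrite leib_ann //; apply: foldr_ann => d.
  by rewrite mulDl anti_ann addNr.
Qed.

Lemma leib_deg_sum_act D u v w :
  leib_deg u v (foldr Node (Node (Leaf None) w) D) =
  leib_deg u v (foldr Node (Node (Leaf (Some true)) w) D) +
  leib_deg u v (foldr Node (Node (Leaf (Some false)) w) D).
Proof.
rewrite /leib_deg !deg_foldr !ev_foldr /=; case: eqP => _; last by rewrite addr0.
by rewrite mulDl foldr_mulD leibD3 embD.
Qed.

Lemma leib_deg_sum_leaf D u v :
  leib_deg u v (foldr Node (Leaf None) D) =
  leib_deg u v (foldr Node (Leaf (Some true)) D) +
  leib_deg u v (foldr Node (Leaf (Some false)) D).
Proof.
rewrite /leib_deg !deg_foldr !ev_foldr /=; case: eqP => _; last by rewrite addr0.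
by rewrite foldr_mulD leibD3 embD.
Qed.

Lemma leib_deg_eq0 u v w : leib_deg u v w = 0.
Proof.
have gen t : generated Node (Leaf (Some true)) (Leaf (Some false)) (Leaf None) t.
  elim: t => [[[]|]|u' gu v' gv]; last exact: gen_br.
  - exact: (gen_lt _ _ _ _ true).
  - exact: (gen_lt _ _ _ _ false).
  - exact: gen_sum.
have cF := leib_deg_cocycle.
have main := generated_zero cF leib_deg_sum_act leib_deg_sum_leaf _ _ (gen u) (gen v) (gen w).
have [three0|three_neq0] := eqVneq (3%:R : K) 0.
  have three0' : 3 = 0 :> trivext V by rewrite trivext_mulrn /= three0 mul0rn.
  have leaf := leib_deg_sum_leaf [::].
  apply: main => D E; first exact: (H_words3 cF three0' leib_deg_sum_act leaf).
  exact: (F_comm3 cF three0' leib_deg_sum_act leaf).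
have three_free (r : trivext V) : 3 * r = 0 -> r = 0.
  rewrite mulr_natl trivext_mulrn; case: r => k a [] /=.
  rewrite -mulr_natl -scaler_nat => /eqP; rewrite mulf_eq0 (negPf three_neq0).
  by move=> /eqP -> /eqP; rewrite scaler_eq0 (negPf three_neq0) => /eqP ->.
by apply: main => D E; [exact: (H_eq0 cF)|exact: (F_comm_not3 cF)].
Qed.

End Trees.

Lemma leib_ev (two_neq0 : (2%:R : K) != 0) g1 g2 u v w :
  leib (ev g1 g2 u) (ev g1 g2 v) (ev g1 g2 w) = 0.
Proof.
have [n] := ubnP (deg u + deg v + deg w)%N.
elim: n u v w => // n IH u v w le_n.
have ltD a b c : (deg a + deg b + deg c < deg u + deg v + deg w)%N ->
    leib (ev g1 g2 a) (ev g1 g2 b) (ev g1 g2 c) = 0.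
  by move=> lt; apply: IH; exact: leq_trans lt le_n.
have := leib_deg_eq0 two_neq0 ltD u v w.
by rewrite /leib_deg eqxx => /emb_inj.
Qed.

End Identities.
End Algebra.

(** * From monomials to the generated subalgebra *)

Lemma gen2_ev_ind (K : fieldType) (V : lmodType K) (m : V -> V -> V) (a b : V)
    (P : V -> Prop) :
  bilinear_mul m -> P 0 -> (forall (k : K) x y, P x -> P y -> P (k *: x + y)) ->
  (forall t, P (ev m a b t)) -> forall x, gen2 m a b x -> P x.
Proof.
move=> bil P0 Plin Pev x gx.
(* The linear span of the monomials, defined impredicatively; bilinearity makes it a subalgebra. *)
pose S v := forall Q : V -> Prop, Q 0 ->
  (forall (k : K) x y, Q x -> Q y -> Q (k *: x + y)) -> (forall t, Q (ev m a b t)) -> Q v.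
suff : S x by apply.
apply: gx.
- split; first by move=> Q Q0 _ _.
    move=> k u v Su Sv Q Q0 Qlin Qev.
    by apply: (Qlin); [exact: Su Q Q0 Qlin Qev|exact: Sv Q Q0 Qlin Qev].
  move=> u v Su Sv Q Q0 Qlin Qev.
  apply: (Su (fun u => Q (m u v))) => [|k s t Qs Qt|s].
  - by rewrite (mul0l bil).
  - by rewrite bil.1; exact: Qlin.
  apply: (Sv (fun v => Q (m (ev m a b s) v))) => [|k p q Qp Qq|t].
  - by rewrite (mul0r bil).
  - by rewrite bil.2; exact: Qlin.
  exact: (Qev (Node s t)).
- by move=> Q _ _ Qev; exact: (Qev (Leaf (Some true))).
- by move=> Q _ _ Qev; exact: (Qev (Leaf (Some false))).
Qed.

Theorem theorem2 (K : fieldType) (V : lmodType K) (m : V -> V -> V) :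
  (2%:R : K) != 0 -> bilinear_mul m ->
  (binary_leibniz m <->
   [/\ (forall a b : V, leib m a a b = 0),
       (forall a b : V, leib m a b a = 0)
     & (forall a b : V, leib m a b (m a b) = 0)]).
Proof.
move=> two_neq0 bil; split=> [bl|[aab aba abab] a b x y z gx gy gz].
  have ga a b : gen2 m a b a by [].
  have gb a b : gen2 m a b b by [].
  have gab a b : gen2 m a b (m a b).
    by move=> S [_ _ Sm] Sa Sb; exact: Sm.
  by split=> a b; apply: (bl a b).
(* Linearity in each argument reduces the claim to monomials, one argument at a time. *)
move: z gz; apply: (gen2_ev_ind bil) => [|k u v lu lv|t3].
- by rewrite /leib !(mul0r bil) subr0 addr0.
- by rewrite leib_lin3 // lu lv scaler0 addr0.
move: y gy; apply: (gen2_ev_ind bil) => [|k u v lu lv|t2].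
- by rewrite /leib !(mul0r bil, mul0l bil) subr0 addr0.
- by rewrite leib_lin2 // lu lv scaler0 addr0.
move: x gx; apply: (gen2_ev_ind bil) => [|k u v lu lv|t1].
- by rewrite /leib !(mul0r bil, mul0l bil) subr0 addr0.
- by rewrite leib_lin1 // lu lv scaler0 addr0.
exact: leib_ev.
Qed.
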